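(* Let $A$ and $B$ be two unbounded self-adjoint operators in a Hilbert space $\mathcal{H}$ which are generators of strongly continuous semigroups $e^{tA}$ and $e^{tB}$, $t\ge0$, and suppose that $\mathcal{D}^\infty(B)\subset\mathcal{D}^\infty(A)$. Then for any positive integer $N$ and all $\varphi\in\mathcal{D}^\infty(B)$, $$e^{tB}\varphi=\sum_{m=0}^N(-1)^m\frac{t^m}{m!}e^{tA}C_m(A,B)\varphi+R_N(t;A,B)\varphi,$$ where the remainder satisfies $R_N(t;A,B)\varphi=\mathcal{O}(t^{N+1})$ in $\mathcal{H}$ as $t\to0^+$.
   Context: For $m\ge0$, $$C_m(A,B)=\sum_{k=0}^m\binom mk A^k(-B)^{m-k},\qquad \mathcal{D}(C_m(A,B))=\bigcap_{k=0}^m\mathcal{D}(A^kB^{m-k}).$$ $\mathcal{D}^\infty(A)=\bigcap_{n=1}^\infty\mathcal{D}(A^n)$ is the space of $C^\infty$-vectors for $A$, and similarly for $B$. The $\mathcal{O}(t^{N+1})$ bound is in the norm of $\mathcal{H}$, for fixed $\varphi$. *)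

(* Defs.v *)
From HB Require Import structures.
From mathcomp Require Import all_boot all_order all_algebra complex.
From mathcomp Require Import all_classical all_reals all_analysis.

Set Implicit Arguments.
Unset Strict Implicit.
Unset Printing Implicit Defensive.

Import Order.TTheory GRing.Theory Num.Theory.
Import numFieldNormedType.Exports.

Local Open Scope ring_scope.
Local Open Scope classical_set_scope.
Local Open Scope complex_scope.

(* A linear operator in H with domain opdom; the values of the underlying total
   function outside opdom are irrelevant, so operators are to be compared
   through their graphs. *)
Record linop (K : numFieldType) (H : normedModType K) := Linop {
  opdom : set H;
  opfun :> H -> H;
  opdom0 : opdom 0;
  opdomP : forall a x y, opdom x -> opdom y -> opdom (a *: x + y);
  opfunP : forall a x y, opdom x -> opdom y ->
    opfun (a *: x + y) = a *: opfun x + opfun y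
}.

Section LinearOperators.
Variables (K : numFieldType) (H : normedModType K).
Implicit Types A B S T : linop H.

Lemma opfun0 A : A 0 = 0.
Proof.
have /esym := opfunP (-1) (opdom0 A) (opdom0 A).
by rewrite scaler0 addr0 scaleN1r addNr.
Qed.

Definition graph A : set (H * H) := [set p | opdom A p.1 /\ A p.1 = p.2].

Definition idop : linop H.
Proof. by refine (@Linop K H setT id _ _ _). Defined.

Definition oppop A : linop H.
Proof.
refine (@Linop K H (opdom A) (fun x => - A x) (opdom0 A) (@opdomP _ _ A) _).
by move=> a x y Ax Ay; rewrite opfunP// opprD scalerN.
Defined.

Definition compop S T : linop H.
Proof.
refine (@Linop K H [set x | opdom T x /\ opdom S (T x)] (fun x => S (T x))
  _ _ _) => /=.
- by rewrite opfun0; split; exact: opdom0.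
- move=> a x y [Tx STx] [Ty STy]; split; first exact: opdomP.
  by rewrite opfunP//; exact: opdomP.
- by move=> a x y [Tx STx] [Ty STy]; rewrite !opfunP.
Defined.

Definition powop A n : linop H := iter n (compop A) idop.

Definition Dinfty A : set H :=
  \bigcap_(n in [set n | (1 <= n)%N]) opdom (powop A n).

Lemma opdomZ A a x : opdom A x -> opdom A (a *: x).
Proof. by move=> Ax; rewrite -[_ *: _]addr0; apply: opdomP => //; exact: opdom0. Qed.

Lemma opfunZ A a x : opdom A x -> A (a *: x) = a *: A x.
Proof.
move=> Ax; rewrite -[a *: x]addr0 opfunP//; last exact: opdom0.
by rewrite opfun0 addr0.
Qed.

Lemma powop_oppop A n x : opdom (powop A n) x ->
  opdom (powop (oppop A) n) x /\
  powop (oppop A) n x = (-1) ^+ n *: powop A n x.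
Proof.
elim: n => [|n IHn] /=; first by rewrite expr0 scale1r.
move=> [Anx AAnx]; have [? ->] := IHn Anx; split.
  by split=> //; exact: opdomZ.
by rewrite opfunZ// exprS mulN1r scaleNr.
Qed.

Definition commop (m : nat) A B : linop H.
Proof.
refine (@Linop K H
  (\bigcap_(k in [set k | (k <= m)%N])
     opdom (compop (powop A k) (powop B (m - k))))
  (fun x => \sum_(k < m.+1)
     'C(m, k)%:R *: compop (powop A k) (powop (oppop B) (m - k)) x) _ _ _).
- by move=> k _; exact: opdom0.
- by move=> a x y Ax Ay k km; apply: opdomP; [exact: Ax|exact: Ay].
- have dom x (k : 'I_m.+1) : (\bigcap_(k in [set k | (k <= m)%N])
      opdom (compop (powop A k) (powop B (m - k)))) x ->
      opdom (compop (powop A k) (powop (oppop B) (m - k))) x.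
    move=> /(_ k); have km : (k <= m)%N by rewrite -ltnS.
    move=> /(_ km)[Bx ABx]; have [oBx oBE] := powop_oppop Bx.
    by split=> //; rewrite oBE; exact: opdomZ.
  move=> a x y Ax Ay; rewrite scaler_sumr -big_split/=; apply: eq_bigr => k _.
  have := opfunP a (dom x k Ax) (dom y k Ay) => /= ->.
  by rewrite scalerDr !scalerA mulrC.
Defined.

End LinearOperators.

Section Hilbert.
Variables (R : realType) (H : normedModType R[i]).
Implicit Types (dot : {dot H for Num.conj}) (A : linop H).

(* H is a Hilbert space with inner product dot when it is complete and its norm
   is the one induced by dot. *)
Definition induces_norm dot := forall x : H, dot x x = `|x| ^+ 2.

Definition adjoint_graph dot A : set (H * H) :=
  [set p | forall x, opdom A x -> dot (A x) p.1 = dot x p.2].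

Definition self_adjoint dot A :=
  dense (opdom A) /\ graph A = adjoint_graph dot A.

(* The values at t < 0 are irrelevant. *)
Record C0_semigroup := C0Semigroup {
  semigroup :> R -> {linear H -> H};
  semigroup_bounded : forall t, 0 <= t -> continuous (semigroup t);
  semigroup0 : forall x, semigroup 0 x = x;
  semigroupD : forall s t, 0 <= s -> 0 <= t ->
    forall x, semigroup (s + t) x = semigroup s (semigroup t x);
  semigroup_cvg : forall x, semigroup t x @[t --> 0^'+] --> x
}.

Definition generator_graph (T : C0_semigroup) : set (H * H) :=
  [set p | t%:C^-1 *: (T t p.1 - p.1) @[t --> 0^'+] --> p.2].

Definition is_generator A T := graph A = generator_graph T.

End Hilbert.

(* Main.v *)
Require Import Defs.
From mathcomp Require Import all_boot all_order all_algebra complex.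
From mathcomp Require Import all_classical all_reals all_analysis.
From mathcomp Require Import ring lra.

(** Write T and S for the semigroups generated by A and B. The formal reason for
    the expansion is e^{tB} = e^{tA} (e^{-tA} e^{tB}), where e^{-tA} e^{tB} is
    replaced by the product of the two power series with all A's to the left of
    all B's; the term of degree m of that product is (-1)^m t^m/m! C_m(A,B).
    Since e^{-tA} need not exist, the proof only uses the following two
    expansions of an orbit t |-> T_t x, valid for x in the domain of A^(n+1):
      T_t x = sum_(k <= n) t^k/k! A^k x + O(t^(n+1))             (forward),
      x = sum_(k <= n) (-t)^k/k! T_t A^k x + O(t^(n+1))          (backward).
    Reordering the double sum by the power j of B ([commop_expansion]) gives
      sum_(m <= N) (-1)^m t^m/m! T_t C_m phi
        = sum_(j <= N) t^j/j! sum_(k <= N-j) (-t)^k/k! T_t A^k (B^j phi).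
    The inclusion of the smooth vectors of B among those of A makes B^j phi
    smooth for A, so the backward expansion replaces the inner sum by
    B^j phi + O(t^(N-j+1)); what is left is the forward expansion of S_t phi, up
    to O(t^(N+1)).

    Both expansions are the fundamental theorem of calculus for one function:
      F_c(t) = sum_(k <= n) (c-t)^k/k! T_t A^k x
    has the right derivative (c-t)^n/n! T_t A^(n+1) x, because the sum telescopes
    ([orbit_taylor_right_derive]). On [0, s] this is O(s^n) when 0 <= c <= s, so
    F_c(s) - F_c(0) = O(s^(n+1)); the case c = s is the forward expansion and the
    case c = 0 is the backward one.

    The increment of F_c is controlled by a mean value inequality that asks only
    for a right derivative and for continuity from the left
    ([mean_value_right]). Continuity from the left of the orbits is where
    completeness enters: T_t x - T_(t-h) x = T_(t-h) (T_h x - x), and one needs a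
    bound on the operators T_s that is uniform for small s. It follows from the
    uniform boundedness principle, applied to the families {T_s : s <= 1/(k+1)}
    ([uniform_boundedness], [semigroup_locally_bounded]). *)

Set Implicit Arguments.
Unset Strict Implicit.
Unset Printing Implicit Defensive.

Import Order.TTheory GRing.Theory Num.Theory.
Import numFieldNormedType.Exports.

Local Open Scope ring_scope.
Local Open Scope classical_set_scope.
Local Open Scope complex_scope.

(** * Real-valued norms and one-sided limits *)

Lemma gt0_complexE {R : realType} (e : R[i]) : 0 < e -> e = (complex.Re e)%:C.
Proof. by move=> e0; rewrite RRe_real// gtr0_real. Qed.

Lemma near_0rightP {R : realType} (P : set R) :
  (\forall h \near 0^'+, P h) <->
  exists2 d, 0 < d & forall h, 0 < h -> h < d -> P h.
Proof.
split=> [[d /= d0 dP]|[d d0 dP]].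
  by exists d => // h h0 hd; apply: dP => //=; rewrite sub0r normrN gtr0_norm.
near=> h; apply: dP; near: h; first exact: nbhs_right_gt.
exact: nbhs_right_lt.
Unshelve. all: by end_near. Qed.

Section RealNorm.
Context {R : realType} {V : normedModType R[i]}.
Implicit Types (x y : V) (r : R).

(** The norm of [V] takes its values in the partially ordered field [R[i]];
    [rnorm] reads it in [R], where sups and linear arithmetic are at hand. *)
Definition rnorm x : R := complex.Re `|x|.

Lemma rnormE x : `|x| = (rnorm x)%:C.
Proof. by rewrite /rnorm RRe_real// normr_real. Qed.

Lemma rnorm_ge0 x : 0 <= rnorm x.
Proof. by rewrite -lecR -rnormE (normr_ge0 x). Qed.

Lemma ler_rnormD x y : rnorm (x + y) <= rnorm x + rnorm y.
Proof. by rewrite -lecR rmorphD/= -!rnormE ler_normD. Qed.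

Lemma rnormN x : rnorm (- x) = rnorm x.
Proof. by rewrite /rnorm normrN. Qed.

Lemma rnorm0 : rnorm 0 = 0.
Proof. by rewrite /rnorm normr0. Qed.

Lemma rnormZ r x : rnorm (r%:C *: x) = `|r| * rnorm x.
Proof.
apply: complexI; rewrite -rnormE normrZ rnormE rmorphM/=; congr (_ * _).
by rewrite normc_def/= expr0n/= addr0 sqrtr_sqr.
Qed.

Lemma rnorm_eq0 x : rnorm x = 0 -> x = 0.
Proof. by move=> x0; apply/eqP; rewrite -normr_eq0 rnormE x0. Qed.

Lemma ler_rnormB_split y x z : rnorm (x - z) <= rnorm (x - y) + rnorm (y - z).
Proof. by rewrite (le_trans _ (ler_rnormD _ _))// addrA subrK. Qed.

Lemma rnormB x y : rnorm (x - y) = rnorm (y - x).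
Proof. by rewrite -rnormN opprB. Qed.

Lemma cvg_rnormP T (F : set_system T) {FF : Filter F} (f : T -> V) y :
  f @ F --> y <-> forall e, 0 < e -> \forall t \near F, rnorm (y - f t) <= e.
Proof.
split=> [/cvgrPdist_le fy e e0|fy].
  have /fy : 0 < e%:C by rewrite ltcR.
  by apply: filterS => t; rewrite rnormE lecR.
apply/cvgrPdist_le => e e0.
have eE := gt0_complexE e0.
rewrite eE ltcR in e0; apply: filterS (fy _ e0) => t.
by rewrite rnormE {2}eE lecR.
Qed.

Lemma cvg_rnorm_seqP (u : nat -> V) y :
  u @ \oo --> y <->
  forall e, 0 < e -> exists N, forall n, (N <= n)%N -> rnorm (y - u n) <= e.
Proof.
rewrite cvg_rnormP; split=> uy e /uy.
  by case=> N _ uN; exists N.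
by case=> N uN; exists N.
Qed.

End RealNorm.

Section BigO.
Context {R : realType} {H : normedModType R[i]}.
Implicit Types (f g : R -> H).

(** [f t = O(t^n)] as [t --> 0^+], with the constant in [R]. *)
Definition bigO_pow n (f : R -> H) :=
  exists M, \forall t \near 0^'+, rnorm (f t) <= M * t ^+ n.

Lemma bigO_powB n f g :
  bigO_pow n f -> bigO_pow n g -> bigO_pow n (fun t => f t - g t).
Proof.
move=> [M fM] [M' gM]; exists (M + M'); near=> t.
rewrite (le_trans (ler_rnormD _ _))// rnormN mulrDl lerD//; near: t => //.
Unshelve. all: by end_near. Qed.

Lemma bigO_pow_sum n m (f : nat -> R -> H) :
  (forall j, (j < m)%N -> bigO_pow n (f j)) ->
  bigO_pow n (fun t => \sum_(j < m) f j t).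
Proof.
elim: m => [|m IH] fO.
  by exists 0; near=> t; rewrite big_ord0 rnorm0 mul0r.
have [M fM] : bigO_pow n (fun t => \sum_(j < m) f j t).
  by apply: IH => j /ltnW; exact: fO.
have [M' gM] := fO m (ltnSn m); exists (M + M'); near=> t.
rewrite big_ord_recr /= (le_trans (ler_rnormD _ _))// mulrDl lerD//; near: t => //.
Unshelve. all: by end_near. Qed.

(** The coefficients [t^j/j!] are estimated by [t^j]. *)
Lemma bigO_powZ n j f : bigO_pow n f ->
  bigO_pow (j + n) (fun t => (t ^+ j / j`!%:R)%:C *: f t).
Proof.
move=> [M fM]; exists M; near=> t.
have t0 : 0 < t by near: t; exact: nbhs_right_gt.
rewrite rnormZ ger0_norm ?divr_ge0 ?exprn_ge0 ?(ltW t0)// exprD mulrCA.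
rewrite ler_pM ?rnorm_ge0 ?divr_ge0 ?exprn_ge0 ?(ltW t0)//; last by near: t.
by rewrite ler_pdivrMr ?ltr0n ?fact_gt0// ler_peMr ?exprn_ge0 ?(ltW t0)// ler1n fact_gt0.
Unshelve. all: by end_near. Qed.

Lemma bigO_powP n f : bigO_pow n f ->
  f =O_ (0^'+) (fun t : R => t%:C ^+ n : R[i]^o).
Proof.
move=> [M fM]; apply/eqO_exP; exists (`|M| + 1)%:C; first by rewrite ltcR ltr_wpDl.
near=> t.
have t0 : 0 < t by near: t; exact: nbhs_right_gt.
rewrite -rmorphXn rnormE.
have -> : `|(t ^+ n)%:C : R[i]^o| = (t ^+ n)%:C.
  by rewrite normc_def/= expr0n/= addr0 sqrtr_sqr ger0_norm// exprn_ge0// ltW.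
rewrite -rmorphM lecR (@le_trans _ _ (M * t ^+ n))//; first by near: t.
by rewrite ler_wpM2r ?exprn_ge0 ?(ltW t0)// (le_trans (ler_norm M))// lerDl.
Unshelve. all: by end_near. Qed.

End BigO.

(** * Uniform boundedness *)

Section UniformBoundedness.
Context {R : realType} {V : completeNormedModType R[i]}.

(** Completeness in the form needed by a Baire argument: the two bounds say
    that the closed ball of radius [r k.+1] around [x k.+1] lies in that of
    radius [r k] around [x k]. *)
Lemma nested_balls (x : nat -> V) (r : nat -> R) :
  (forall k, 0 < r k) -> (forall k, r k.+1 <= r k / 2) ->
  (forall k, rnorm (x k.+1 - x k) <= r k / 2) ->
  exists y, forall k, rnorm (y - x k) <= r k.
Proof.
move=> r0 rS xS.
have nest k : forall n, rnorm (x (k + n)%N - x k) <= r k - r (k + n)%N.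
  elim=> [|n IH]; first by rewrite addn0 !subrr rnorm0.
  have := ler_rnormB_split (x (k + n)%N) (x (k + n.+1)%N) (x k).
  by rewrite addnS; have := xS (k + n)%N; have := rS (k + n)%N; lra.
have {}nest k n : (k <= n)%N -> rnorm (x n - x k) <= r k.
  by move=> /subnKC <-; have := nest k (n - k)%N; have := r0 (k + (n - k))%N; lra.
have rle k : r k <= r 0%N / 2 ^+ k.
  elim: k => [|k IH]; first by rewrite expr0 divr1.
  by rewrite (le_trans (rS k))// exprSr invfM mulrA ler_pM2r.
have r_small e : 0 < e -> exists k, r k <= e.
  move=> e0; have : (fun k => r 0%N * (1/2) ^+ k) @ \oo --> (0 : R).
    rewrite -(mulr0 (r 0%N)); apply: cvgM; first exact: cvg_cst.
    by apply: cvg_expr; rewrite ger0_norm; lra.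
  move=> /cvgr0Pnorm_le/(_ e e0)[N _ /(_ N (leqnn N))/=].
  rewrite ger0_norm; last by rewrite mulr_ge0 ?exprn_ge0 ?divr_ge0// ltW.
  by rewrite expr_div_n expr1n div1r => rN; exists N; exact: le_trans (rle N) rN.
have cx : cvg (x @ \oo).
  apply: cauchy_cvg; apply: cauchy_exP => e e0.
  have eE := gt0_complexE e0.
  rewrite eE ltcR in e0; have [|k rk] := r_small (complex.Re e / 2).
    by rewrite divr_gt0.
  exists (x k); exists k => // n /= kn; rewrite -ball_normE /= eE rnormE ltcR rnormB.
  by have := nest _ _ kn; lra.
move/cvg_ex: cx => [y /cvg_rnorm_seqP xy]; exists y => k.
apply/ler_addgt0Pr => e /xy[N /(_ (maxn N k))]; rewrite leq_maxl => /(_ isT) h.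
have := ler_rnormB_split (x (maxn N k)) y (x k).
by have := nest k (maxn N k) (leq_maxr _ _); lra.
Qed.

(** The uniform boundedness principle along a decreasing sequence of families, so
    that for each [x] only the members of some [F k] have to be bounded at [x].
    If no [F k] is uniformly bounded, then every ball contains a smaller one on
    which some member of [F k] exceeds [k]; the common point of a nested sequence
    of such balls contradicts pointwise boundedness. *)
Lemma uniform_boundedness (F : nat -> set {linear V -> V}) :
  (forall k f, F k f -> continuous f) ->
  (forall k l, (k <= l)%N -> F l `<=` F k) ->
  (forall x, exists k M, forall f, F k f -> rnorm (f x) <= M) ->
  exists k M, 0 <= M /\ forall f, F k f -> forall x, rnorm (f x) <= M * rnorm x.
Proof.
move=> Fcont Fdecr Fbnd; apply: contrapT => /forallNP unbnd.
have step k (p : V * {posnum R}) : exists q : V * {posnum R},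
    [/\ q.2%:num <= p.2%:num / 2, rnorm (q.1 - p.1) <= p.2%:num / 2 &
      exists2 f, F k f & forall y, rnorm (y - q.1) <= q.2%:num ->
                                   k%:R < rnorm (f y)].
  case: p => x r /=.
  have [y [f [yx Ff fy]]] : exists y (f : {linear V -> V}),
      [/\ rnorm (y - x) <= r%:num / 2, F k f & k%:R < rnorm (f y)].
    apply: contrapT => small; apply: (unbnd k).
    have {}small f y : F k f -> rnorm (y - x) <= r%:num / 2 -> rnorm (f y) <= k%:R.
      by move=> Ff yx; rewrite leNgt; apply/negP => fy; apply: small; exists y, f.
    (* |f| <= k on the ball of radius r/2 around x gives |f| <= 2k on the ball of
       radius r/2 around 0, by linearity. *)
    exists (4 * k%:R / r%:num); split; first by rewrite divr_ge0// mulr_ge0.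
    move=> f Ff z; have [->|z0] := eqVneq z 0.
      by rewrite linear0 rnorm0 mulr0.
    have nz : 0 < rnorm z.
      by rewrite lt_neqAle rnorm_ge0 andbT eq_sym; apply: contra_neq z0 => /rnorm_eq0.
    pose a := r%:num / 2 / rnorm z.
    have a0 : 0 < a by rewrite !divr_gt0.
    have h1 : rnorm (f x) <= k%:R by apply: small => //; rewrite subrr rnorm0.
    have h2 : rnorm (f (x + a%:C *: z)) <= k%:R.
      by apply: small => //; rewrite addrC addKr rnormZ gtr0_norm// /a divfK// gt_eqF.
    have h3 : a * rnorm (f z) <= k%:R + k%:R.
      rewrite -[a]gtr0_norm// -rnormZ -linearZ.
      rewrite -[_ *: z](addKr x) linearD linearN addrC.
      by rewrite (le_trans (ler_rnormD _ _))// rnormN lerD.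
    move: h3; rewrite -ler_pdivlMl// => /le_trans; apply.
    rewrite le_eqVlt; apply/orP; left; apply/eqP; rewrite /a; field.
    by rewrite !gt_eqF.
  have [d d0 fd] : exists2 d, 0 < d & forall z, rnorm (z - y) <= d ->
      k%:R < rnorm (f z).
    have e2 : 0 < (rnorm (f y) - k%:R) / 2 by rewrite divr_gt0// subr_gt0.
    have /cvg_rnormP/(_ _ e2)/nbhs_ballP[e /= e0 fe] := Fcont _ _ Ff y.
    have eE := gt0_complexE e0.
    rewrite eE ltcR in e0; exists (complex.Re e / 2); first by rewrite divr_gt0.
    move=> z zy; have := fe z; rewrite -ball_normE /= eE rnormE ltcR (rnormB y) => /(_ _)/wrap[].
      by rewrite (le_lt_trans zy)// ltr_pdivrMr// mulr_natr mulr2n ltrDl.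
    by have := ler_rnormB_split (f z) (f y) 0; rewrite !subr0; lra.
  have e0 : 0 < Num.min d (r%:num / 2) by rewrite lt_min d0 divr_gt0.
  exists (y, PosNum e0); split => //=; first by rewrite ge_min lexx orbT.
  by exists f => // z; rewrite le_min => /andP[/fd].
have [g gP] := choice (fun kp : nat * (V * {posnum R}) => step kp.1 kp.2).
pose s := fix s k := if k is k'.+1 then g (k', s k') else (0 : V, PosNum (@ltr01 R)).
have [|k|k|y yP] := @nested_balls (fun k => (s k).1) (fun k => (s k).2%:num).
- by move=> k.
- by have [] := gP (k, s k).
- by have [] := gP (k, s k).
have [k0 [M yM]] := Fbnd y.
pose k := maxn k0 (Num.truncn M).+1.
have [_ _ [f Ff fy]] := gP (k, s k).
have := fy y (yP k.+1); apply/negP; rewrite -leNgt.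
have /yM/le_trans : F k0 f by apply: Fdecr Ff; rewrite leq_maxl.
by apply; rewrite (le_trans (ltW (truncnS_gt M)))// ler_nat leq_maxr.
Qed.

End UniformBoundedness.

(** * A mean value inequality for right derivatives *)

Section RightDerivative.
Context {R : realType} {V : normedModType R[i]}.
Implicit Types (f g : R -> V) (t : R).

Definition right_derive f t (l : V) :=
  h%:C^-1 *: (f (t + h) - f t) @[h --> 0^'+] --> l.

Definition left_continuous f t := f (t - h) @[h --> 0^'+] --> f t.

(** For [e > 0] let [S] be the set of the [t] with
    [|f t - f 0| <= (M + e) t]. Continuity from the left shows that the supremum of
    [S] belongs to [S], and the right derivative pushes it beyond any point [< s]. *)
Lemma mean_value_right f g s M : 0 <= s ->
  (forall t, 0 < t <= s -> left_continuous f t) ->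
  (forall t, 0 <= t < s -> right_derive f t (g t)) ->
  (forall t, 0 <= t < s -> rnorm (g t) <= M) ->
  rnorm (f s - f 0) <= M * s.
Proof.
move=> s0 fl fr gM.
have [->|sn0] := eqVneq s 0; first by rewrite subrr rnorm0 mulr0.
have {sn0}s0 : 0 < s by rewrite lt_neqAle eq_sym sn0.
have M0 : 0 <= M by apply: le_trans (rnorm_ge0 _) (gM 0 _); rewrite lexx.
suff slack e : 0 < e -> rnorm (f s - f 0) <= (M + e) * s.
  apply/ler_addgt0Pr => e e0; rewrite (le_trans (slack (e / s) _))//.
    by rewrite divr_gt0.
  by rewrite mulrDl divfK// gt_eqF.
move=> e0; pose S : set R := [set t | 0 <= t <= s /\ rnorm (f t - f 0) <= (M + e) * t].
have S0 : S 0 by split; [rewrite lexx ltW|rewrite subrr rnorm0 mulr0].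
have Sub : ubound S s by move=> t [/andP[]].
have bS : has_ubound S by exists s.
have supS : has_sup S by split; [exists 0|].
have leS t : S t -> t <= sup S by exact: ub_le_sup.
have u0 : 0 <= sup S by exact: leS.
have us : sup S <= s by apply: ge_sup => //; exists 0.
have Su : S (sup S).
  split; first by rewrite u0 us.
  have [uz|un0] := eqVneq (sup S) 0; first by rewrite uz subrr rnorm0 mulr0.
  have up : 0 < sup S by rewrite lt_neqAle eq_sym un0.
  apply/ler_addgt0Pr => e1 e10.
  have /fl/cvg_rnormP/(_ e1 e10)/near_0rightP[d d0 dP] : 0 < sup S <= s by rewrite up.
  have [t St td] := sup_adherent d0 supS.
  have := leS _ St; rewrite le_eqVlt => /predU1P[tu|tu].
    by have [_ h] := St; rewrite -tu; lra.
  have := dP (sup S - t); rewrite subKr => /(_ _ _)/wrap[]; [lra|lra|move=> h].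
  have [_ h'] := St; have := ler_rnormB_split (f t) (f (sup S)) (f 0).
  have : (M + e) * t <= (M + e) * sup S by rewrite ler_wpM2l ?ltW//; lra.
  lra.
have [->|uns] := eqVneq s (sup S); first by have [] := Su.
have {}us : sup S < s by rewrite lt_neqAle eq_sym uns.
have uI : 0 <= sup S < s by rewrite u0.
have /cvg_rnormP/(_ e e0)/near_0rightP[d d0 dP] := fr _ uI.
pose h := Num.min (d / 2) (s - sup S).
have h0 : 0 < h by rewrite lt_min divr_gt0//= subr_gt0.
have hd : h < d by rewrite gt_min; apply/orP; left; lra.
have hs : h <= s - sup S by rewrite ge_min lexx orbT.
have := dP h h0 hd; set q := _ *: _ => qe.
have fq : f (sup S + h) - f (sup S) = h%:C *: q.
  by rewrite /q scalerA mulfV ?scale1r//; apply: contraTN h0 => /eqP[->]; rewrite ltxx.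
have {}fq : rnorm (f (sup S + h) - f (sup S)) <= (M + e) * h.
  rewrite fq rnormZ gtr0_norm// mulrC ler_pM2r//.
  have := ler_rnormB_split (g (sup S)) q 0; rewrite !subr0 (rnormB q).
  by have := gM _ uI; lra.
have : S (sup S + h).
  split; first by apply/andP; split; lra.
  have [_ hS] := Su.
  by have := ler_rnormB_split (f (sup S)) (f (sup S + h)) (f 0); lra.
by move=> /leS; lra.
Qed.

Lemma left_continuousD f g t :
  left_continuous f t -> left_continuous g t ->
  left_continuous (fun s => f s + g s) t.
Proof. exact: cvgD. Qed.

Lemma right_deriveD f g t l k :
  right_derive f t l -> right_derive g t k ->
  right_derive (fun s => f s + g s) t (l + k).
Proof.
move=> fl gk; apply: cvg_trans (cvgD fl gk); apply: near_eq_cvg; near=> h.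
by rewrite -[LHS]/(_ *: _ + _ *: _) -scalerDr addrACA -opprD.
Unshelve. all: by end_near. Qed.

End RightDerivative.

Section ScalarMultiples.
Context {R : realType} {V : normedModType R[i]}.
Implicit Types (q : R -> R) (f : R -> V) (t : R).

Lemma cvg_real_complex T (F : set_system T) {FF : Filter F} (u : T -> R) (a : R) :
  u @ F --> a -> ((u x)%:C : R[i]^o) @[x --> F] --> (a%:C : R[i]^o).
Proof.
move=> /cvgrPdist_le ua; apply/cvgrPdist_le => e e0.
have eE := gt0_complexE e0.
rewrite eE ltcR in e0; apply: filterS (ua _ e0) => x.
by rewrite -rmorphB normc_def/= expr0n/= addr0 sqrtr_sqr {2}eE lecR.
Qed.

Lemma cvg_0right_shift q t : {for t, continuous q} -> q (t + h) @[h --> 0^'+] --> q t.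
Proof.
move=> qt; have : t + h @[h --> 0^'+] --> t + 0.
  by apply: cvgD; [exact: cvg_cst|exact: cvg_within].
by rewrite addr0 => /cvg_comp; apply.
Qed.

Lemma cvg_0right_shiftN q t : {for t, continuous q} -> q (t - h) @[h --> 0^'+] --> q t.
Proof.
move=> qt; have : t - h @[h --> 0^'+] --> t - 0.
  by apply: cvgB; [exact: cvg_cst|exact: cvg_within].
by rewrite subr0 => /cvg_comp; apply.
Qed.

Lemma left_continuousZ q f t : {for t, continuous q} -> left_continuous f t ->
  left_continuous (fun t => (q t)%:C *: f t) t.
Proof.
move=> /cvg_0right_shiftN qt ft; apply: cvgZ => //.
exact: cvg_real_complex.
Qed.

(** Leibniz rule, with the increment split as
    [(q (t + h) - q t) f t + q (t + h) (f (t + h) - f t)] so that only [q] is taken to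
    its limit outside the difference quotients. *)
Lemma right_deriveZ q f t (q' : R) (l : V) : is_derive t 1 q q' -> right_derive f t l ->
  right_derive (fun t => (q t)%:C *: f t) t (q'%:C *: f t + (q t)%:C *: l).
Proof.
move=> dq ft.
have qt : {for t, continuous q}.
  by apply/differentiable_continuous/derivable1_diffP; exact: ex_derive.
have {}dq : h^-1 * (q (t + h) - q t) @[h --> 0^'+] --> q'.
  rewrite -(derive_val (is_derive := dq)); apply: cvg_dnbhs_at_right.
  have := ex_derive (is_derive := dq); rewrite /derive /derivable => dq1.
  apply: cvg_trans dq1; apply: near_eq_cvg; near=> h => /=.
  by rewrite /GRing.scale/= mulr1 (addrC h).
rewrite /right_derive /=.
have -> : (fun h => h%:C^-1 *: ((q (t + h))%:C *: f (t + h) - (q t)%:C *: f t)) =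
    (fun h => (h^-1 * (q (t + h) - q t))%:C *: f t +
              (q (t + h))%:C *: (h%:C^-1 *: (f (t + h) - f t))).
  apply/funext => h; rewrite rmorphM/= rmorphB/= fmorphV.
  rewrite -scalerA (scalerA (q (t + h))%:C) (mulrC (q (t + h))%:C) -scalerA -scalerDr.
  by congr (_ *: _); rewrite scalerBl scalerBr [in RHS]addrC addrA subrK.
apply: cvgD; first by apply: cvgZr_tmp; exact: cvg_real_complex.
by apply: cvgZ => //; apply: cvg_real_complex; exact: cvg_0right_shift.
Unshelve. all: by end_near. Qed.

Lemma is_derive_taylor_monomial (c t : R) k :
  is_derive t 1 (fun t => (c - t) ^+ k.+1 / k.+1`!%:R) (- ((c - t) ^+ k / k`!%:R)).
Proof.
rewrite (_ : (fun _ => _) = (k.+1`!%:R^-1 : R) *: ((cst c - id) ^+ k.+1 : R -> R)).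
  apply: is_derive_eq.
  rewrite /= sub0r fctE factS natrM.
  rewrite /GRing.scale/= mulrN1 mulrN; congr (- _).
  by field; rewrite nat1r !pnatr_eq0 andbT -lt0n fact_gt0.
by apply/funext => s; rewrite fctE mulrC; congr (_ * _).
Qed.

End ScalarMultiples.

(** * Smooth vectors and orbits of a semigroup *)

Section SmoothVectors.
Context {K : numFieldType} {H : normedModType K}.
Implicit Types (A : linop H) (x : H).

Lemma Dinfty_opdom A n x : Dinfty A x -> opdom (powop A n) x.
Proof. by case: n => // n; apply. Qed.

(** Since [powop A n.+1] is [A] composed after [powop A n], applying [A] first
    instead requires this commutation. *)
Lemma powopSr A n x : opdom (powop A n.+1) x ->
  [/\ opdom A x, opdom (powop A n) (A x) & powop A n (A x) = powop A n.+1 x].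
Proof.
elim: n => [|n IH] /=; first by case.
by move=> [Anx]; have [Ax AnAx /= <-] := IH Anx.
Qed.

Lemma Dinfty_opfun A x : Dinfty A x -> Dinfty A (A x).
Proof. by move=> Ax n _; have /powopSr[] := @Dinfty_opdom A n.+1 x Ax. Qed.

Lemma Dinfty_powop A n x : Dinfty A x -> Dinfty A (powop A n x).
Proof. by move=> Ax; elim: n => //= n IH; exact: Dinfty_opfun. Qed.

End SmoothVectors.

Section Semigroup.
Context {R : realType} {H : completeNormedModType R[i]}.
Variables (T : C0_semigroup H).

(** The orbit of each [x] is bounded on an interval that depends on [x], by strong
    continuity at 0; the uniform boundedness principle makes the interval and the
    bound common to all [x]. *)
Lemma semigroup_locally_bounded : exists d M : R,
  [/\ 0 < d, 0 <= M &
      forall t x, 0 <= t <= d -> rnorm (T t x) <= M * rnorm x].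
Proof.
pose F k := [set f : {linear H -> H} |
  exists2 t : R, 0 <= t <= k.+1%:R^-1 & f = semigroup T t].
have [|k l kl f [t tl ->]|x|k [M [M0 FM]]] := @uniform_boundedness R H F.
- by move=> k f [t /andP[t0 _] ->]; exact: semigroup_bounded.
- exists t => //; case/andP: tl => -> /le_trans; apply.
  by rewrite lef_pV2 ?posrE// ler_nat.
- have /cvg_rnormP/(_ 1 ltr01)/near_0rightP[d d0 dT] := @semigroup_cvg _ _ T x.
  exists (Num.truncn d^-1), (rnorm x + 1) => f [t /andP[t0 td] ->].
  have [->|tn0] := eqVneq t 0; first by rewrite semigroup0 lerDl.
  have tp : 0 < t by rewrite lt_neqAle eq_sym tn0.
  have {}td : t < d.
    by rewrite (le_lt_trans td)// invf_plt ?posrE// truncnS_gt.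
  have := dT t tp td; have := ler_rnormB_split x (T t x) 0.
  by rewrite !subr0 (rnormB _ x); lra.
- exists k.+1%:R^-1, M; split => // t x tk.
  by apply: FM; exists t.
Qed.

(** [T t x - T (t - h) x = T (t - h) (T h x - x)]. *)
Lemma semigroup_left_continuous (d M : R) x t :
  0 <= M -> (forall s y, 0 <= s <= d -> rnorm (T s y) <= M * rnorm y) ->
  0 < t <= d -> left_continuous (fun s => T s x) t.
Proof.
move=> M0 TM /andP[t0 td]; apply/cvg_rnormP => e e0.
have eM : 0 < e / (M + 1) by rewrite divr_gt0// ltr_wpDl.
have /cvg_rnormP/(_ _ eM)/near_0rightP[d' d'0 dT] := @semigroup_cvg _ _ T x.
apply/near_0rightP; exists (Num.min d' t); first by rewrite lt_min d'0.
move=> h h0; rewrite lt_min => /andP[hd' ht].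
have -> : T t x = T (t - h) (T h x) by rewrite -semigroupD ?subrK//; lra.
rewrite -linearB (le_trans (TM _ _ _))//; first by apply/andP; split; lra.
have := dT h h0 hd'; rewrite rnormB => xe.
rewrite (@le_trans _ _ ((M + 1) * (e / (M + 1))))//.
  by rewrite ler_pM ?rnorm_ge0// lerDl.
by rewrite mulrC divfK// gt_eqF// ltr_wpDl.
Qed.

(** [(T (t + h) x - T t x) / h = T t ((T h x - x) / h)], and [T t] is continuous. *)
Lemma semigroup_right_derive (A : linop H) x t : is_generator A T ->
  0 <= t -> opdom A x -> right_derive (fun s => T s x) t (T t (A x)).
Proof.
move=> genA t0 Ax; rewrite /right_derive.
have : generator_graph T (x, A x) by rewrite -genA.
rewrite /generator_graph/= => Txl.
have := cvg_comp _ _ Txl (@semigroup_bounded _ _ T t t0 (A x)).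
apply: cvg_trans; apply: near_eq_cvg; near=> h.
by rewrite /= linearZ linearB/= semigroupD.
Unshelve. all: by end_near. Qed.

End Semigroup.

(** * Forward and backward Taylor expansions of an orbit *)

Section Taylor.
Context {R : realType} {H : completeNormedModType R[i]}.
Variables (A : linop H) (T : C0_semigroup H).
Hypothesis genA : is_generator A T.
Implicit Types (x : H) (c s t : R).

(** The Taylor polynomial at [t] of the orbit of [x], evaluated at [c]. It is
    regarded as a function of [t] with [c] fixed: its derivative telescopes. *)
Definition orbit_taylor x c n t : H :=
  \sum_(k < n.+1) ((c - t) ^+ k / k`!%:R)%:C *: T t (powop A k x).

Lemma orbit_taylorS x c n : orbit_taylor x c n.+1 = fun t =>
  orbit_taylor x c n t + ((c - t) ^+ n.+1 / n.+1`!%:R)%:C *: T t (powop A n.+1 x).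
Proof. by apply/funext => t; rewrite /orbit_taylor big_ord_recr. Qed.

Lemma orbit_taylor0 x c : orbit_taylor x c 0 = fun t => T t x.
Proof. by apply/funext => t; rewrite /orbit_taylor big_ord1 expr0 divr1 scale1r. Qed.

(** The derivative of the coefficient of [T t (A^k x)] cancels the contribution of
    the derivative of [T t (A^(k-1) x)]; only the last term survives. *)
Lemma orbit_taylor_right_derive x c n t : 0 <= t -> opdom (powop A n.+1) x ->
  right_derive (orbit_taylor x c n) t
    (((c - t) ^+ n / n`!%:R)%:C *: T t (powop A n.+1 x)).
Proof.
move=> t0; elim: n => [|n IH] Anx.
  rewrite expr0 divr1 scale1r orbit_taylor0.
  exact: semigroup_right_derive genA t0 (proj2 Anx).
rewrite orbit_taylorS; have [/IH Tn AAnx] := Anx.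
have := right_deriveD Tn (right_deriveZ (is_derive_taylor_monomial c t n)
  (semigroup_right_derive genA t0 AAnx)).
by rewrite rmorphN scaleNr addrA subrr add0r.
Qed.

Lemma orbit_taylor_left_continuous x c n t :
  (forall y, left_continuous (fun s => T s y) t) ->
  left_continuous (orbit_taylor x c n) t.
Proof.
move=> Tt; elim: n => [|n IH]; first by rewrite orbit_taylor0.
rewrite orbit_taylorS; apply: left_continuousD => //; apply: left_continuousZ => //.
have dq := is_derive_taylor_monomial c t n.
by apply/differentiable_continuous/derivable1_diffP; exact: ex_derive.
Qed.

(** On [[0, s]] one has [|c - t| <= s], so the right derivative is
    bounded by a constant times [s^n]. The constant serves all [c] in [[0, s]],
    in particular the choices [c = s] and [c = 0] made below. *)
Lemma orbit_taylor_remainder x n : opdom (powop A n.+1) x ->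
  exists d M, 0 < d /\ forall c s, 0 <= c <= s -> s <= d ->
    rnorm (orbit_taylor x c n s - orbit_taylor x c n 0) <= M * s ^+ n.+1.
Proof.
move=> Anx; have [d [M [d0 M0 TM]]] := semigroup_locally_bounded T.
exists d, (M * rnorm (powop A n.+1 x)); split=> // c s /andP[c0 cs] sd.
rewrite exprSr mulrA; apply: (@mean_value_right _ _ _ (fun t =>
  ((c - t) ^+ n / n`!%:R)%:C *: T t (powop A n.+1 x))); first exact: le_trans cs.
- move=> t /andP[t0 ts]; apply: orbit_taylor_left_continuous => y.
  by apply: semigroup_left_continuous TM _ => //; rewrite t0 (le_trans ts).
- by move=> t /andP[t0 _]; exact: orbit_taylor_right_derive.
- move=> t /andP[t0 ts]; rewrite rnormZ mulrC ler_pM ?rnorm_ge0//.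
    by apply: TM; rewrite t0 (le_trans (ltW ts)).
  have cts : `|c - t| <= s by rewrite ler_norml; apply/andP; split; lra.
  rewrite normrM normrX normfV normr_nat ler_pdivrMr ?ltr0n ?fact_gt0//.
  rewrite (@le_trans _ _ (s ^+ n))//; first by rewrite lerXn2r ?nnegrE// (le_trans _ cs).
  by rewrite ler_peMr ?exprn_ge0 ?(le_trans c0)// ler1n fact_gt0.
Qed.

(** [orbit_taylor_remainder] at [c = s]: there the polynomial reduces to
    [T s x]. *)
Lemma semigroup_taylor x n : opdom (powop A n.+1) x ->
  bigO_pow n.+1 (fun t => T t x - \sum_(k < n.+1) (t ^+ k / k`!%:R)%:C *: powop A k x).
Proof.
move=> /orbit_taylor_remainder[d [M [d0 dM]]]; exists M.
apply/near_0rightP; exists d => // t t0 td.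
have := dM t t; rewrite (ltW t0) lexx => /(_ isT (ltW td)).
congr (rnorm (_ - _) <= _).
  rewrite /orbit_taylor big_ord_recl /= subrr expr0 divr1 scale1r.
  by rewrite big1 ?addr0// => k _; rewrite /= expr0n/= mul0r scale0r.
by rewrite /orbit_taylor; apply: eq_bigr => k _; rewrite subr0 semigroup0.
Qed.

(** [orbit_taylor_remainder] at [c = 0]: this plays the part of
    [e^{-tA} e^{tA} x = x] without running the semigroup backwards. *)
Lemma semigroup_taylor_backward x n : opdom (powop A n.+1) x ->
  bigO_pow n.+1
    (fun t => \sum_(k < n.+1) ((- t) ^+ k / k`!%:R)%:C *: T t (powop A k x) - x).
Proof.
move=> /orbit_taylor_remainder[d [M [d0 dM]]]; exists M.
apply/near_0rightP; exists d => // t t0 td.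
have := dM 0 t; rewrite (ltW t0) lexx => /(_ isT (ltW td)).
congr (rnorm (_ - _) <= _).
  by rewrite /orbit_taylor; apply: eq_bigr => k _; rewrite sub0r.
rewrite /orbit_taylor big_ord_recl /= subrr expr0 divr1 scale1r semigroup0.
by rewrite big1 ?addr0// => k _; rewrite /= expr0n/= mul0r scale0r.
Qed.

End Taylor.

(** * The commutator expansion *)

Lemma triangular_sum (V : nmodType) (F : nat -> nat -> V) N :
  \sum_(m < N) \sum_(k < m.+1) F k (m - k)%N =
  \sum_(j < N) \sum_(k < N - j) F k j.
Proof.
elim: N => [|N IH]; first by rewrite !big_ord0.
rewrite big_ord_recr /= IH [RHS]big_ord_recr /= subSnn big_ord1.
under [in RHS]eq_bigr => j _ do rewrite subSn ?(ltnW (ltn_ord j))// big_ord_recr/=.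
rewrite big_split /= -addrA; congr (_ + _).
rewrite (reindex_inj rev_ord_inj) big_ord_recr /= subSS subnn subn0; congr (_ + _).
by apply: eq_bigr => j _; rewrite !subSS subKn// ltnW.
Qed.

Section Expansion.
Context {R : realType} {H : completeNormedModType R[i]}.
Variables (A B : linop H) (TA TB : C0_semigroup H).
Hypothesis A_generator : is_generator A TA.
Hypothesis B_generator : is_generator B TB.
Hypothesis Dinfty_sub : Dinfty B `<=` Dinfty A.

Lemma commop_dom m phi : Dinfty B phi -> opdom (commop m A B) phi.
Proof.
move=> Bphi k _; split; first exact: Dinfty_opdom.
by apply/Dinfty_opdom/Dinfty_sub/Dinfty_powop.
Qed.

Lemma commopE m phi : Dinfty B phi ->
  commop m A B phi = \sum_(k < m.+1)
    ('C(m, k)%:R * (-1) ^+ (m - k)) *: powop A k (powop B (m - k) phi).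
Proof.
move=> Bphi; apply: eq_bigr => k _ /=.
have [_ ->] := powop_oppop (@Dinfty_opdom _ _ B (m - k) phi Bphi).
rewrite opfunZ ?scalerA//.
by apply/Dinfty_opdom/Dinfty_sub/Dinfty_powop.
Qed.

(** [t^m/m! 'C(m, k)] is [t^k/k! * t^(m-k)/(m-k)!], and of the signs
    [(-1)^m (-1)^(m-k)] there remains [(-1)^k], which goes with the powers of
    [A]. *)
Lemma commop_coef (t : R) m k : (k <= m)%N ->
  (-1) ^+ m * (t%:C ^+ m / m`!%:R) * ('C(m, k)%:R * (-1) ^+ (m - k)) =
  (t ^+ (m - k) / (m - k)`!%:R)%:C * ((- t) ^+ k / k`!%:R)%:C :> R[i].
Proof.
move=> km; have := bin_fact km; move: (m - k)%N (subnKC km) => j <- bf.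
have f0 n : n`!%:R != 0 :> R by rewrite pnatr_eq0 -lt0n fact_gt0.
have -> : (-1) ^+ (k + j) * (t%:C ^+ (k + j) / (k + j)`!%:R) *
    ('C(k + j, k)%:R * (-1) ^+ j) =
  ((-1) ^+ (k + j) * (t ^+ (k + j) / (k + j)`!%:R) *
    ('C(k + j, k)%:R * (-1) ^+ j) : R)%:C.
  by rewrite !rmorphM/= fmorphV/= !rmorphXn/= !rmorph_nat rmorphN1.
rewrite -rmorphM/=; congr (_%:C).
have C0 : 'C(k + j, k)%:R != 0 :> R by rewrite pnatr_eq0 -lt0n bin_gt0 leq_addr.
rewrite -bf !natrM (exprNn t k) !exprD.
(* After this the claim is an identity between rational functions, up to the
   square of the sign (-1)^j. *)
have s1 : (-1) ^+ j * (-1) ^+ j = 1 :> R by rewrite -exprMn mulrNN mul1r expr1n.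
have -> : forall a b c d e f g : R, c != 0 -> f != 0 -> g != 0 -> b * b = 1 ->
   a * b * (d * e / (c * (f * g))) * (c * b) = e / g * (a * d / f).
  by move=> a b c d e f g c0 f_0 g0 bb; rewrite -[RHS]mulr1 -bb; field; rewrite c0 f_0 g0.
all: by [].
Qed.

Lemma commop_expansion N (t : R) phi : Dinfty B phi ->
  \sum_(m < N) ((-1) ^+ m * (t%:C ^+ m / m`!%:R)) *: TA t (commop m A B phi) =
  \sum_(j < N) (t ^+ j / j`!%:R)%:C *:
    \sum_(k < N - j) ((- t) ^+ k / k`!%:R)%:C *: TA t (powop A k (powop B j phi)).
Proof.
move=> Bphi; under [RHS]eq_bigr do rewrite scaler_sumr.
rewrite -(triangular_sum (fun k j => (t ^+ j / j`!%:R)%:C *: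
  (((- t) ^+ k / k`!%:R)%:C *: TA t (powop A k (powop B j phi))))).
apply: eq_bigr => m _; rewrite commopE// linear_sum scaler_sumr.
apply: eq_bigr => k _; rewrite linearZ !scalerA commop_coef//.
by rewrite -ltnS.
Qed.

(** The error is that of the forward expansion of [TB t phi] minus, for each [j],
    [t^j/j!] times that of the backward expansion of [B^j phi] at order
    [N - j + 1]. *)
Lemma semigroup_commop_remainder N phi : Dinfty B phi ->
  bigO_pow N.+1 (fun t => TB t phi -
    \sum_(m < N.+1) ((-1) ^+ m * (t%:C ^+ m / m`!%:R)) *: TA t (commop m A B phi)).
Proof.
move=> Bphi.
have : bigO_pow N.+1 (fun t => \sum_(j < N.+1) (t ^+ j / j`!%:R)%:C *:
    (\sum_(k < N.+1 - j) ((- t) ^+ k / k`!%:R)%:C *: TA t (powop A k (powop B j phi))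
     - powop B j phi)).
  apply: (@bigO_pow_sum _ _ _ _ (fun j t => (t ^+ j / j`!%:R)%:C *:
    (\sum_(k < N.+1 - j) ((- t) ^+ k / k`!%:R)%:C *: TA t (powop A k (powop B j phi))
     - powop B j phi))) => j; rewrite ltnS => jN.
  rewrite -{1}(subnKC jN) -addnS subSn//; apply: bigO_powZ.
  by apply: semigroup_taylor_backward => //; apply/Dinfty_opdom/Dinfty_sub/Dinfty_powop.
move=> /(bigO_powB (semigroup_taylor B_generator (@Dinfty_opdom _ _ B N.+1 phi Bphi))).
congr bigO_pow; apply/funext => t; rewrite commop_expansion//.
under [X in _ - _ - X]eq_bigr do rewrite scalerBr.
by rewrite sumrB opprB addrA subrK.
Qed.

End Expansion.

Theorem theorem5p1 (R : realType) (H : completeNormedModType R[i])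
    (dot : {dot H for Num.conj}) (dot_norm : induces_norm dot)
    (A B : linop H) (TA TB : C0_semigroup H)
    (A_self_adjoint : self_adjoint dot A) (B_self_adjoint : self_adjoint dot B)
    (A_generator : is_generator A TA) (B_generator : is_generator B TB)
    (Dinfty_sub : Dinfty B `<=` Dinfty A) (N : nat) (N_gt0 : (0 < N)%N) :
  exists RN : R -> H -> H, forall phi : H, Dinfty B phi ->
    [/\ forall m : nat, (m <= N)%N -> opdom (commop m A B) phi,
        forall t : R, 0 <= t ->
          TB t phi =
          \sum_(m < N.+1)
             ((-1) ^+ m * (t%:C ^+ m / m`!%:R)) *: TA t (commop m A B phi)
          + RN t phi
      & (RN^~ phi : R -> H) =O_ (0^'+) (fun t : R => t%:C ^+ N.+1 : R[i]^o)].
Proof.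
exists (fun t phi => TB t phi -
  \sum_(m < N.+1) ((-1) ^+ m * (t%:C ^+ m / m`!%:R)) *: TA t (commop m A B phi)).
move=> phi Bphi; split=> [m _|t _|]; first exact: commop_dom.
  by rewrite addrC subrK.
exact/bigO_powP/semigroup_commop_remainder.
Qed.
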